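(* Let $T$ be a tree with at least two vertices. Then $\beta(T) = \gamma_{\mathrm{m}}^{\infty}(T)$ if and only if repeated (zero or more) applications of operation EWS reduce $T$ to $K_1$ or $K_2$.
   Context: All graphs are finite. For a graph $G=(V,E)$, an $\mathrm{m}$-eternal dominating set game is played as follows. The defender chooses a set $D_1\subseteq V$ of vertices occupied by guards (at most one guard per vertex). For each $i\ge 1$, the attacker (who sees the guard positions) chooses a vertex $r_i\in V\setminus D_i$, and the defender responds by letting each guard either stay in place or move to an adjacent vertex, producing a new set $D_{i+1}$ (again with at most one guard per vertex, so $|D_{i+1}|=|D_i|$) with $r_i\in D_{i+1}$. Every $D_i$ is required to be a dominating set. The $\mathrm{m}$-eternal domination number $\gamma_{\mathrm{m}}^{\infty}(G)$ is the least number of guards with which the defender can successfully respond to every infinite sequence of attacks. $\beta(G)$ is the independence number of $G$, the maximum size of an independent set. A leaf of a tree is a vertex of degree one; an internal vertex is a vertex that is not a leaf. A stem is a vertex of degree at least two that is adjacent to a leaf. A stem is weak if it is adjacent to exactly one leaf and strong if it is adjacent to at least two leaves. A stem $s$ of a tree is exposed if it has at most one neighbor that is an internal vertex of the tree; a tree with at most two vertices has no exposed stems. Operation EWS: if there is an exposed weak stem in the current tree, delete it and the leaf adjacent to it. In addition, operation EWS may be applied to the path $P_3$ on three vertices, where it deletes the middle vertex and one of its leaves, leaving $K_1$. *)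

(* Defs.v *)
From mathcomp Require Import all_boot boolp.

Set Implicit Arguments.
Unset Strict Implicit.
Unset Printing Implicit Defensive.

Section Graph.
Variables (V : finType) (e : rel V).
Implicit Types (A B D : {set V}) (s l v : V).

Definition simple_graph := symmetric e /\ irreflexive e.

(* On a symmetric irreflexive relation, a duplicate-free closed walk of length
   at most 2 is empty or goes back and forth along one edge. *)
Definition acyclic := forall c : seq V, ucycle e c -> size c <= 2.

Definition tree :=
  [/\ simple_graph, 0 < #|V|, forall x y, connect e x y & acyclic].

Definition independent A := [forall x in A, forall y in A, ~~ e x y].

Definition independence_number := \max_(A : {set V} | independent A) #|A|.

Definition dominating D := [forall x, (x \in D) || [exists y in D, e x y]].

Definition guards_move D D' :=
  exists f : V -> V,
    [/\ {in D &, injective f},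
        {in D, forall v, f v = v \/ e v (f v)}
      & D' = f @: D].

(* A strategy maps the list of the attacks made so far to the set of guarded
   vertices; its value at [::] is the initial placement. *)
Definition strategy := seq V -> {set V}.

Definition position (sigma : strategy) (r : nat -> V) (i : nat) : {set V} :=
  sigma (mkseq r i).

(* Only attacks on unguarded vertices are legal. Legality is required of each
   prefix rather than of the whole of r, so that a defender with a guard on
   every vertex, who leaves the attacker without a move, still has to have
   answered all the earlier attacks. *)
Definition winning (sigma : strategy) :=
  forall (r : nat -> V) (i : nat),
    (forall j, j < i -> r j \notin position sigma r j) ->
    dominating (position sigma r i) /\
    (r i \notin position sigma r i ->
       r i \in position sigma r i.+1 /\
       guards_move (position sigma r i) (position sigma r i.+1)).

Definition defended_by (k : nat) :=
  exists2 sigma : strategy, #|sigma [::]| = k & winning sigma.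

Lemma defended_by_all : exists k, `[< defended_by k >].
Proof.
exists #|V|; apply/asboolP; exists (fun _ => [set: V]); first by rewrite cardsT.
move=> r i _; rewrite /position; split; last by rewrite inE.
by apply/forallP=> x; rewrite inE.
Qed.

Definition m_eternal_domination_number : nat := ex_minn defended_by_all.

(* The current tree of a reduction is the subgraph induced by a set A of
   vertices; the notions below refer to that subgraph. *)

Definition nbrs A v := [set w in A | e v w].

Definition leaf A v := (v \in A) && (#|nbrs A v| == 1).

Definition internal A v := (v \in A) && ~~ leaf A v.

Definition leaf_nbrs A v := [set w in nbrs A v | leaf A w].

Definition stem A s :=
  [&& s \in A, 2 <= #|nbrs A s| & 0 < #|leaf_nbrs A s|].

Definition weak_stem A s := stem A s && (#|leaf_nbrs A s| == 1).

(* Stems have degree at least two, so there is none when #|A| <= 2. *)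
Definition exposed_stem A s :=
  stem A s && (#|[set w in nbrs A s | internal A w]| <= 1).

(* The subgraph induced by A is the path a - b - c. *)
Definition induces_P3 A a b c :=
  [&& A == [set a; b; c], a != c, e a b, e b c & ~~ e a c].

Definition ews : rel {set V} := fun A B =>
  [exists s, exists l,
     [&& weak_stem A s, exposed_stem A s, l \in leaf_nbrs A s
       & B == A :\: [set s; l]]]
  || [exists a, exists b, exists c,
        induces_P3 A a b c && (B == A :\: [set a; b])].

Definition induces_complete A (n : nat) :=
  (#|A| == n) && [forall x in A, forall y in A, (x != y) ==> e x y].

End Graph.

(* Main.v *)
Require Import Defs.
From mathcomp Require Import all_boot boolp.
From mathcomp Require Import perm.

(** EWS removes a leaf and its neighbour of degree two, which lowers both
    parameters by exactly one: a guard confined to the removed edge defends it,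
    and conversely retracting the removed edge onto its attachment vertex turns
    a defence into one with one guard fewer. So only trees A admitting no EWS
    and different from K1 and K2 have to be shown to satisfy gamma < beta. Stars
    are defended by two guards. Otherwise the ends of a longest path of internal
    vertices are two distinct exposed stems x and y, both strong. Let L be the
    leaves at x. One of A - L and A - L - x has even order, but no perfect
    matching because of the two leaves at y; hence EWS does not reduce it to K1
    or K2, and by induction it satisfies gamma < beta. Putting L, or L and x,
    back costs one, respectively two, guards, and raises beta by at least as
    much. *)

Set Implicit Arguments.
Unset Strict Implicit.
Unset Printing Implicit Defensive.

Section Guards.
Variables (V : finType) (e : rel V).
Hypotheses (e_sym : symmetric e) (e_irr : irreflexive e).
Implicit Types (A B C D J L X : {set V}) (a b l r s u v w x y : V).

(** * Neighbourhoods and moves of guards *)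

Lemma in_nbrs A v w : (w \in nbrs e A v) = (w \in A) && e v w.
Proof. by rewrite inE. Qed.

Lemma mem_nbrs A v w : w \in A -> e v w -> w \in nbrs e A v.
Proof. by rewrite in_nbrs => ->. Qed.

Lemma edge_neq v w : e v w -> v != w.
Proof. by apply: contraTneq => ->; rewrite e_irr. Qed.

Lemma disjoint_setD A B : [disjoint B & A :\: B].
Proof. by rewrite -setI_eq0 setDE setICA setICr setI0. Qed.

Lemma guards_move_refl D : guards_move e D D.
Proof.
by exists id; split=> [x y //|v _|]; [left | rewrite imset_id].
Qed.

Lemma guards_move1 v w : v = w \/ e v w -> guards_move e [set v] [set w].
Proof.
move=> vw; exists (fun=> w); split; last by rewrite imset_set1.
  by move=> x y /set1P -> /set1P ->.
by move=> x /set1P ->; case: vw => [->|]; [left | right].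
Qed.

Lemma guards_moveU D1 D2 D1' D2' :
  [disjoint D1 & D2] -> [disjoint D1' & D2'] ->
  guards_move e D1 D1' -> guards_move e D2 D2' ->
  guards_move e (D1 :|: D2) (D1' :|: D2').
Proof.
move=> dis dis' [f [f_inj f_move eqf]] [g [g_inj g_move eqg]].
pose h x := if x \in D1 then f x else g x.
have hf : {in D1, h =1 f} by move=> x xD; rewrite /h xD.
have hg : {in D2, h =1 g}.
  by move=> x xD; rewrite /h (disjointFl dis).
have nfg x y : x \in D1 -> y \in D2 -> f x <> g y.
  move=> xD yD eqxy; have : f x \in D1' by rewrite eqf imset_f.
  by rewrite eqxy => /(disjointFr dis'); rewrite eqg imset_f.
exists h; split.
- move=> x y /setUP[] xD /setUP[] yD.
  + by rewrite !hf //; apply: f_inj.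
  + by rewrite hf // hg // => /nfg; case.
  + by rewrite hg // hf // => /esym/nfg; case.
  + by rewrite !hg //; apply: g_inj.
- by move=> x /setUP[] xD; rewrite ?(hf _ xD) ?(hg _ xD); auto.
- by rewrite imsetU (eq_in_imset hf) (eq_in_imset hg) eqf eqg.
Qed.

Lemma card_guards_move D D' : guards_move e D D' -> #|D'| = #|D|.
Proof. by case=> f [f_inj _ ->]; apply: card_in_imset. Qed.

Lemma guards_move_dominated D D' x :
  guards_move e D D' -> x \in D' -> x \notin D -> exists2 y, y \in D & e x y.
Proof.
case=> f [_ f_move ->] /imsetP[v vD ->] fvD; exists v => //.
by rewrite e_sym; case: (f_move v vD) fvD => // ->; rewrite vD.
Qed.

(** * Defences as invariant families of positions *)

(** [Q] is a family of safe positions, so the defender needs no memory. Attacks on guarded vertices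
    are included, and domination is a consequence of answering every attack. *)
Definition defence A k (Q : {set V} -> Prop) :=
  [/\ exists D, Q D,
      forall D, Q D -> D \subset A /\ #|D| = k
    & forall D r, Q D -> r \in A ->
        exists D', [/\ Q D', r \in D' & guards_move e D D']].

Definition defendable A k := exists Q, defence A k Q.

(** The safe positions are those reached by legal sequences of attacks. A new attack prolongs the
    sequence; an attack on a guarded vertex is met by standing still. *)
Lemma defended_by_defendable k :
  0 < #|V| -> defended_by e k -> defendable [set: V] k.
Proof.
move=> /card_gt0P[v0 _] [sigma card_sigma win].
pose legal (att : nat -> V) i := forall j, j < i -> att j \notin position sigma att j.
exists (fun D => exists att i, legal att i /\ D = position sigma att i).
split=> [|_ [att [i [leg ->]]]|_ x [att [i [leg ->]]] _].
- by exists (sigma [::]), (fun=> v0), 0.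
- split; first exact: subsetT.
  elim: i leg => [//|i IHi] leg.
  have leg' : legal att i by move=> j ji; apply: leg; apply: ltnW.
  case: (win att i leg') => _ /(_ (leg i (ltnSn i)))[_ /card_guards_move ->].
  exact: IHi.
- have [xD|xD] := boolP (x \in position sigma att i).
    exists (position sigma att i); split=> //; last exact: guards_move_refl.
    by exists att, i.
  (* [att'] repeats the first [i] attacks and then attacks [x], so all positions of index at most
     [i] agree. *)
  pose att' j := if j < i then att j else x.
  have eq_pos j : j <= i -> position sigma att' j = position sigma att j.
    move=> ji; congr sigma; apply/eq_in_map=> h; rewrite mem_iota add0n => hj.
    by rewrite /att' (leq_trans hj ji).
  have att'i : att' i = x by rewrite /att' ltnn.
  have leg' : legal att' i.
    by move=> j ji; rewrite eq_pos ?(ltnW ji) // /att' ji leg.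
  case: (win att' i leg') => _; rewrite att'i eq_pos // => /(_ xD)[xD' mv].
  exists (position sigma att' i.+1); split=> //.
  exists att', i.+1; split=> // j; rewrite ltnS leq_eqVlt => /predU1P[->|]; last exact: leg'.
  by rewrite att'i eq_pos.
Qed.

(** A response function obtained by choice is iterated along the history of attacks. *)
Lemma defendable_defended_by k : defendable [set: V] k -> defended_by e k.
Proof.
case=> Q [[D0 QD0] cardQ respQ].
have /choice[next nextP] : forall Dr : {set V} * V, exists D', Q Dr.1 ->
    [/\ Q D', Dr.2 \in D' & guards_move e Dr.1 D'].
  (* Outside [Q] the response is a dummy value. *)
  case=> D r; case: (pselect (Q D)) => [QD|nQD]; last by exists D.
  by case: (respQ D r QD (in_setT r)) => D' ?; exists D'.
pose sigma h := foldl (fun D r => next (D, r)) D0 h.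
exists sigma; first by case: (cardQ _ QD0).
move=> att i _.
have posS j : position sigma att j.+1 = next (position sigma att j, att j).
  by rewrite /position /sigma mkseqS foldl_rcons.
have Qpos : Q (position sigma att i).
  by elim: i => [//|i IHi]; rewrite posS; case: (nextP (_, att i) IHi).
split=> [|_]; last by rewrite posS; case: (nextP (_, att i) Qpos).
(* An unguarded [x] is dominated by the guard that would answer an attack on it. *)
apply/forallP=> x; case: (boolP (x \in _)) => //= xD.
case: (nextP (_, x) Qpos) => _ /= xD' mv.
by case: (guards_move_dominated mv xD' xD) => y yD exy; apply/exists_inP; exists y.
Qed.

Lemma m_eternal_le k : defendable [set: V] k -> m_eternal_domination_number e <= k.
Proof.
move=> /defendable_defended_by defk; rewrite /m_eternal_domination_number.
by case: ex_minnP => m _; apply; apply/asboolP.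
Qed.

Lemma m_eternal_defendable :
  0 < #|V| -> defendable [set: V] (m_eternal_domination_number e).
Proof.
move=> V0; rewrite /m_eternal_domination_number.
by case: ex_minnP => m /asboolP /(defended_by_defendable V0).
Qed.

(** * Defences of cliques, disjoint unions and added leaves *)

Definition clique C := {in C &, forall x y, x != y -> e x y}.

Lemma clique2 s l : e s l -> clique [set s; l].
Proof.
by move=> esl x y /set2P[]-> /set2P[]->; rewrite ?eqxx // e_sym.
Qed.

Lemma defendable_clique C : clique C -> C != set0 -> defendable C 1.
Proof.
move=> clC /set0Pn[x0 x0C]; exists (fun D => exists2 x, x \in C & D = [set x]).
split=> [|_ [x xC ->]|_ r [x xC ->] rC]; first by exists [set x0], x0.
  by rewrite sub1set cards1.
exists [set r]; split; [by exists r | exact: set11 | apply: guards_move1].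
by have [->|/clC] := eqVneq x r; [left | right; auto].
Qed.

(** Two teams play side by side: the one whose part is attacked responds while the other stands
    still. *)
Lemma defendableU A B k m : [disjoint A & B] ->
  defendable A k -> defendable B m -> defendable (A :|: B) (k + m).
Proof.
move=> dis [Q [[D QD] subQ respQ]] [R [[E RE] subR respR]].
have disQR D1 E1 : Q D1 -> R E1 -> [disjoint D1 & E1].
  move=> /subQ[D1A _] /subR[E1B _].
  exact: disjointWl D1A (disjointWr E1B dis).
exists (fun F => exists D E, [/\ Q D, R E & F = D :|: E]); split.
- by exists (D :|: E), D, E.
- move=> _ [D1 [E1 [QD1 RE1 ->]]]; have dis1 := disQR _ _ QD1 RE1.
  case: (subQ _ QD1) (subR _ RE1) => [DA cD] [EB cE].
  by rewrite setUSS // cardsU (disjoint_setI0 dis1) cards0 subn0 cD cE.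
- move=> _ r [D1 [E1 [QD1 RE1 ->]]] /setUP[] rAB.
    case: (respQ _ _ QD1 rAB) => D2 [QD2 rD2 mv]; exists (D2 :|: E1).
    split; [by exists D2, E1 | by rewrite inE rD2 |].
    by apply: guards_moveU => //; [exact: disQR | exact: disQR | exact: guards_move_refl].
  case: (respR _ _ RE1 rAB) => E2 [RE2 rE2 mv]; exists (D1 :|: E2).
  split; [by exists D1, E2 | by rewrite inE rE2 orbT |].
  by apply: guards_moveU => //; [exact: disQR | exact: disQR | exact: guards_move_refl].
Qed.

(* The additional guard stands on x, unless the guards of A already occupy x:
   it then stands on one of the new leaves. *)
Lemma defendable_add_leaves A L x k : x \in A -> L != set0 ->
  [disjoint A & L] -> {in L, forall l, e x l} ->
  defendable A k -> defendable (A :|: L) k.+1.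
Proof.
move=> xA /set0Pn[a aL] dis exL [Q [[D0 QD0] subQ respQ]].
pose spare D g := if x \in D then g \in L else g == x.
have spareN D g : Q D -> spare D g -> g \notin D.
  case/subQ=> /subsetP DA _; rewrite /spare; case: ifPn => [_ gL|xD /eqP-> //].
  by apply/negP=> /DA /(disjointFr dis); rewrite gL.
have dis1 D g : Q D -> spare D g -> [disjoint [set g] & D].
  by move=> QD gD; rewrite disjoints1 spareN.
exists (fun F => exists D g, [/\ Q D, spare D g & F = [set g] :|: D]); split.
- exists ([set if x \in D0 then a else x] :|: D0), D0, (if x \in D0 then a else x).
  by split=> //; rewrite /spare; case: (x \in D0).
- move=> _ [D [g [QD gD ->]]]; case: (subQ _ QD) => DA cD.
  split; last by rewrite cardsU1 spareN // cD.
  rewrite subUset sub1set inE (subset_trans DA (subsetUl _ _)) andbT.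
  by move: gD; rewrite /spare; case: ifP => [_ ->|_ /eqP->]; rewrite ?orbT ?xA.
- move=> _ r [D [g [QD gD ->]]] /setUP[rA|rL].
    (* The attack is in [A]: the spare guard moves between [x] and [L] according to whether the
       other guards vacate or occupy [x]. *)
    case: (respQ _ _ QD rA) => D' [QD' rD' mv].
    suff [g' g'D' gg'] : exists2 g', spare D' g' & g = g' \/ e g g'.
      exists ([set g'] :|: D'); split; [by exists D', g' | by rewrite inE rD' orbT |].
      by apply: guards_moveU => //; [exact: dis1 | exact: dis1 | exact: guards_move1].
    move: gD; rewrite /spare; case: (x \in D) => [gL|/eqP->]; case: (x \in D').
    + by exists g => //; left.
    + by exists x => //; right; rewrite e_sym exL.
    + by exists a => //; right; rewrite exL.
    + by exists x => //; left.
  (* A leaf [r] is attacked. If [x] is guarded by [D], that guard goes to [r] and the spare one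
     replaces it on [x]. *)
  have [xD|xD] := boolP (x \in D).
    have spr : spare D r by rewrite /spare xD.
    exists ([set r] :|: D); split; [by exists D, r | by rewrite !inE eqxx |].
    have -> : [set g] :|: D = [set g] :|: ([set x] :|: D :\ x).
      by rewrite setD1K.
    have -> : [set r] :|: D = [set x] :|: ([set r] :|: D :\ x).
      by rewrite -{1}(setD1K xD) setUCA.
    have gL : g \in L by move: gD; rewrite /spare xD.
    have Lx y : y \in L -> y != x.
      by apply: contraTneq => ->; rewrite (disjointFr dis xA).
    apply: guards_moveU.
    + by rewrite disjoints1 setD1K // spareN.
    + by rewrite disjoints1 !inE eqxx /= orbF eq_sym Lx.
    + by apply: guards_move1; right; rewrite e_sym exL.
    + apply: guards_moveU; last exact: guards_move_refl.
      * by rewrite disjoints1 !inE eqxx.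
      * by rewrite disjoints1 !inE (negPf (spareN _ _ QD spr)) andbF.
      * by apply: guards_move1; right; rewrite exL.
  (* Here the spare guard stands on [x]. The others respond as if [x] were attacked, which frees it
     to go to [r]. *)
  case: (respQ _ _ QD xA) => D' [QD' xD' mv].
  have spr : spare D' r by rewrite /spare xD'.
  exists ([set r] :|: D'); split; [by exists D', r | by rewrite !inE eqxx |].
  apply: guards_moveU => //; [exact: dis1 | exact: dis1 | apply: guards_move1].
  by move: gD; rewrite /spare (negPf xD) => /eqP->; right; rewrite exL.
Qed.

(** * Independence numbers of induced subgraphs *)

Definition beta A :=
  \max_(X : {set V} | (X \subset A) && independent e X) #|X|.

Lemma beta_setT : beta [set: V] = independence_number e.
Proof. by apply: eq_bigl => X; rewrite subsetT. Qed.

Lemma independentP X : reflect {in X &, forall x y, ~~ e x y} (independent e X).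
Proof.
apply: (iffP forall_inP) => [indX x y xX yX|indX x xX].
  by move/forall_inP: (indX x xX); apply.
by apply/forall_inP=> y; apply: indX.
Qed.

Lemma leq_beta A X : X \subset A -> independent e X -> #|X| <= beta A.
Proof. by move=> XA iX; apply: leq_bigmax_cond; rewrite XA. Qed.

Lemma beta_witness A : exists X, [/\ X \subset A, independent e X & #|X| = beta A].
Proof.
have [|X /andP[XA iX] eqX] := @eq_bigmax_cond _
    [pred X : {set V} | (X \subset A) && independent e X] (fun X : {set V} => #|X|).
  apply/card_gt0P; exists set0; rewrite !inE sub0set /=.
  by apply/independentP=> x y; rewrite inE.
by exists X.
Qed.

(** An independent set contains at most one vertex of a clique. *)
Lemma beta_del_clique A C : clique C -> beta A <= (beta (A :\: C)).+1.
Proof.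
move=> clC; case: (beta_witness A) => X [XA /independentP iX <-].
rewrite -(cardsID C X) -addn1 addnC leq_add //.
  apply: leq_beta; first exact: setSD.
  by apply/independentP=> x y /setDP[xX _] /setDP[yX _]; apply: iX.
apply/card_le1_eqP=> x y /setIP[xX xC] /setIP[yX yC].
by have [//|/(clC _ _ xC yC)] := eqVneq x y; rewrite (negPf (iX _ _ xX yX)).
Qed.

(** Vertices of [L] have no neighbour in [A] except possibly [x], so [L] can be added to any
    independent set avoiding [x]. *)
Lemma beta_add_leaves A L x : L \subset A -> x \notin L ->
    {in L, forall l, nbrs e A l \subset [set x]} ->
  beta (A :\: (x |: L)) + #|L| <= beta A.
Proof.
move=> LA xL nbrL.
case: (beta_witness (A :\: (x |: L))) => X [/subsetP XA /independentP iX <-].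
have dis : X :&: L = set0.
  apply/setP=> v; rewrite in_set0 inE; apply/negP=> /andP[/XA].
  by rewrite !inE => /andP[/norP[_ /negPf->]].
have {}XA v : v \in X -> v \in A /\ v != x.
  by move/XA; rewrite !inE => /andP[/norP[-> _] ->].
have nL l v : l \in L -> v \in A -> v != x -> ~~ e l v.
  move=> lL vA; apply: contraNN => elv.
  by have /subsetP/(_ v) := nbrL _ lL; rewrite !inE vA => /(_ elv).
have -> : #|X| + #|L| = #|X :|: L| by rewrite cardsU dis cards0 subn0.
apply: leq_beta.
  by rewrite subUset LA andbT; apply/subsetP=> v /XA[].
have Lx l : l \in L -> l != x by apply: contraTneq => ->.
apply/independentP=> v w /setUP[] vX /setUP[] wX; first exact: iX.
- by case: (XA _ vX) => ? ?; rewrite e_sym nL.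
- by case: (XA _ wX) => ? ?; rewrite nL.
- by rewrite nL ?(subsetP LA) ?Lx.
Qed.

Lemma beta_clique C : clique C -> C != set0 -> beta C = 1.
Proof.
move=> clC /set0Pn[x xC]; apply/eqP; rewrite eqn_leq; apply/andP; split.
  apply: leq_trans (beta_del_clique C clC) _; rewrite setDv ltnS.
  by case: (beta_witness set0) => X [+ _ <-]; rewrite subset0 => /eqP->; rewrite cards0.
rewrite -(cards1 x); apply: leq_beta; first by rewrite sub1set.
by apply/independentP=> v w /set1P-> /set1P->; rewrite e_irr.
Qed.

(** * Pendant pairs and operation EWS *)

(* Both forms of the operation delete a leaf l and its neighbour s of degree two. *)
Definition pendant A s l u :=
  [/\ s \in A, u != l, nbrs e A l = [set s] & nbrs e A s = [set l; u]].

(** All neighbours of a weak stem but one leaf are internal. If the stem is exposed there is at most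
    one of these, and its degree of at least two provides one. In P3 the middle vertex plays the
    part of [s]. *)
Lemma ews_pendant A B : ews e A B ->
  exists s l u, pendant A s l u /\ B = A :\: [set s; l].
Proof.
case/orP=> [/existsP[s /existsP[l]]|].
  case/and4P=> /andP[/and3P[sA deg2 _] /cards1P[l' eql']] /andP[_ int1].
  rewrite eql' => /set1P-> /eqP->; exists s, l'.
  have : l' \in leaf_nbrs e A s by rewrite eql' set11.
  rewrite inE => /andP[l's /andP[l'A /cards1P[s' eqs']]].
  have eqs : nbrs e A l' = [set s].
    have : s \in nbrs e A l' by move: l's; rewrite !in_nbrs sA e_sym => /andP[].
    by rewrite eqs' => /set1P->.
  have : 0 < #|nbrs e A s :\ l'| by move: deg2; rewrite (cardsD1 l') l's.
  case/card_gt0P=> u /setD1P[ul' us]; exists u; split=> //; split=> //.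
  have intu w : w \in nbrs e A s -> w != l' ->
      w \in [set w in nbrs e A s | internal e A w].
    move=> ws wl'; rewrite inE ws /=; apply/andP; split.
      by move: ws; rewrite in_nbrs => /andP[].
    apply: contra wl' => lw; rewrite -in_set1 -eql' inE ws; exact: lw.
  apply/setP=> w; rewrite in_set2; apply/idP/idP => [ws|/pred2P[]-> //].
  have [//|wl'/=] := eqVneq w l'.
  by rewrite (card_le1_eqP int1 w u) ?intu.
case/existsP=> a /existsP[b /existsP[c /andP[/and5P[/eqP eqA ac eab ebc nac]]]].
move=> /eqP->; exists b, a, c; split; last by rewrite setUC.
have bA : b \in A by rewrite eqA !inE eqxx orbT.
split=> //; first by rewrite eq_sym.
  apply/setP=> v; rewrite in_nbrs eqA !inE -orbA.
  have [->|va] := eqVneq v a.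
    rewrite e_irr andbF; symmetry; apply/negbTE.
    by apply: contraTneq eab => ->; rewrite e_irr.
  have [->|vb] := eqVneq v b; first by rewrite eab.
  by have [->|] := eqVneq v c; first rewrite (negPf nac).
apply/setP=> v; rewrite in_nbrs eqA !inE -orbA.
have [->|va] := eqVneq v a; first by rewrite e_sym eab.
have [->|vb] := eqVneq v b.
  rewrite e_irr; symmetry; apply/negbTE.
  by apply: contraTneq ebc => ->; rewrite e_irr.
by have [->|//] := eqVneq v c; rewrite ebc.
Qed.

Section Pendant.
Variables (A : {set V}) (s l u : V).
Hypothesis slu : pendant A s l u.

Lemma pendant_leaf_in : l \in A.
Proof.
case: slu => _ _ _ /setP/(_ l); rewrite in_nbrs set21.
by case/andP.
Qed.

Lemma pendant_root_in : u \in A.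
Proof.
case: slu => _ _ _ /setP/(_ u); rewrite in_nbrs set22.
by case/andP.
Qed.

Lemma pendant_edge : e s l.
Proof.
case: slu => _ _ _ /setP/(_ l); rewrite in_nbrs set21.
by case/andP.
Qed.

Lemma pendant_root_edge : e s u.
Proof.
case: slu => _ _ _ /setP/(_ u); rewrite in_nbrs set22.
by case/andP.
Qed.

Lemma pendant_sub : [set s; l] \subset A.
Proof. by case: slu => sA _ _ _; rewrite subUset !sub1set sA pendant_leaf_in. Qed.

Lemma pendant_beta : beta A = (beta (A :\: [set s; l])).+1.
Proof.
case: slu => sA ul eql eqs; apply/eqP; rewrite eqn_leq.
rewrite beta_del_clique; last exact: clique2 pendant_edge.
rewrite -addn1 -(cards1 l); apply: beta_add_leaves.
- by rewrite sub1set pendant_leaf_in.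
- by rewrite in_set1 edge_neq ?pendant_edge.
- by move=> _ /set1P->; rewrite eql.
Qed.

Lemma pendant_card : #|A| = #|A :\: [set s; l]|.+2.
Proof.
by rewrite -(cardsID [set s; l] A) (setIidPr pendant_sub) cards2 edge_neq ?pendant_edge.
Qed.

Lemma pendant_defendable k :
  defendable (A :\: [set s; l]) k -> defendable A k.+1.
Proof.
move=> defk; rewrite -(setID A [set s; l]) (setIidPr pendant_sub) -add1n.
apply: defendableU defk.
  exact: disjoint_setD.
apply: defendable_clique; first exact: clique2 pendant_edge.
by apply/set0Pn; exists s; rewrite set21.
Qed.

Definition retract v := if v \in [set s; l] then u else v.

(** Within [A], everything at distance at most one from [{s, l}] is [s], [l] or [u], and the
    retraction sends all three to [u]. *)
Lemma retract_nbr v w : v \in [set s; l] -> w \in A -> v = w \/ e v w ->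
  retract w = u.
Proof.
case: slu => sA ul eql eqs vsl wA; rewrite /retract.
case: ifP => // wsl [eqvw|evw]; first by rewrite -eqvw vsl in wsl.
have : w \in nbrs e A v by rewrite in_nbrs wA.
case/set2P: vsl => ->; rewrite ?eqs ?eql.
  by case/set2P=> // wl; rewrite wl set22 in wsl.
by move/set1P=> ws; rewrite ws set21 in wsl.
Qed.

(** The retraction is a weak graph homomorphism: each edge is kept or contracted. *)
Lemma retract_move v w : v \in A -> w \in A -> v = w \/ e v w ->
  retract v = retract w \/ e (retract v) (retract w).
Proof.
move=> vA wA vw; have [vsl|vsl] := boolP (v \in [set s; l]).
  by left; rewrite (retract_nbr vsl wA vw) /retract vsl.
have [wsl|wsl] := boolP (w \in [set s; l]).
  left; rewrite (retract_nbr wsl vA) /retract ?wsl //.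
  by case: vw => [->|evw]; [left | right; rewrite e_sym].
by rewrite /retract (negPf vsl) (negPf wsl); case: vw => [->|]; [left | right].
Qed.

Lemma retract_in v : v \in A -> retract v \in A :\: [set s; l].
Proof.
move=> vA; rewrite /retract inE; case: ifP => [_|-> //].
rewrite pendant_root_in andbT !inE negb_or eq_sym edge_neq ?pendant_root_edge //=.
by case: slu.
Qed.

End Pendant.

(** * Reducible sets: upper bound and perfect matchings *)

Definition reducible A := exists2 B, connect (ews e) A B
  & induces_complete e B 1 \/ induces_complete e B 2.

Lemma induces_completeP A n :
  reflect (#|A| = n /\ clique A) (induces_complete e A n).
Proof.
apply: (iffP andP) => -[cA clA].
  split; first exact/eqP.
  by move=> x y xA yA; move/forall_inP: clA => /(_ x xA)/forall_inP/(_ y yA)/implyP.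
split; first exact/eqP.
by apply/forall_inP=> x xA; apply/forall_inP=> y yA; apply/implyP; apply: clA.
Qed.

(** Induction along a reduction sequence, with K1 and K2 presented as small nonempty cliques and EWS
    as the deletion of a pendant pair. *)
Lemma reducible_ind (P : {set V} -> Prop) :
    (forall C, clique C -> C != set0 -> #|C| <= 2 -> P C) ->
    (forall A s l u, pendant A s l u -> P (A :\: [set s; l]) -> P A) ->
  forall A, reducible A -> P A.
Proof.
move=> P0 PS A [B /connectP[p pA ->] compB].
elim: p A pA compB => [A _|A' p IHp A /= /andP[/ews_pendant[s [l [u [slu ->]]]] pA'] compB].
  by case=> /induces_completeP[cA clA]; apply: P0; rewrite -?card_gt0 ?cA.
exact: PS slu (IHp _ pA' compB).
Qed.

Lemma reducible_ews A B : ews e A B -> reducible B -> reducible A.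
Proof.
by move=> AB [C BC compC]; exists C => //; apply: connect_trans (connect1 AB) BC.
Qed.

Lemma reducible_defendable A : reducible A -> defendable A (beta A).
Proof.
move: A; apply: reducible_ind => [C clC C0 _|A s l u slu].
  by rewrite beta_clique //; apply: defendable_clique.
by rewrite (pendant_beta slu); apply: pendant_defendable slu _.
Qed.

(** EWS preserves parity, so the reduction ends in K2. The deleted edges together with this last
    edge form a perfect matching, given here as an involution [m]. *)
Lemma reducible_even_matching A : reducible A -> ~~ odd #|A| ->
  exists m : V -> V, {in A, forall v, [/\ m v \in A, e v (m v) & m (m v) = v]}.
Proof.
move: A; refine (reducible_ind _ _) => [C clC C0 C2 evenC|A s l u slu IHA].
  have /cards2P[x [y [xy eqC]]] : #|C| == 2.
    by move: C0 C2 evenC; rewrite -card_gt0; case: #|C| => [|[|[]]].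
  have exy : e x y by apply: clC => //; rewrite eqC !inE eqxx ?orbT.
  exists (fun v => if v == x then y else x) => v; rewrite eqC => /set2P[]->.
    by rewrite !eqxx set22 eq_sym (negPf xy).
  by rewrite eq_sym (negPf xy) eqxx set21 e_sym.
rewrite (pendant_card slu) /= negbK => /IHA[m mP].
have esl := pendant_edge slu; have sl := edge_neq esl.
case: (slu) => sA _ _ _; have lA := pendant_leaf_in slu.
exists (fun v => if v == s then l else if v == l then s else m v) => v vA.
have [->|vs] := eqVneq v s; first by rewrite eq_sym (negPf sl) eqxx.
have [->|vl] := eqVneq v l; first by rewrite eqxx e_sym.
have [] := mP v; first by rewrite !inE negb_or vs vl.
by rewrite !inE negb_or => /andP[/andP[/negPf-> /negPf->] mvA].
Qed.

(** A perfect matching would have to match both leaves to [y]. *)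
Lemma twin_leaves_irreducible A y a b : a != b ->
    a \in A -> b \in A -> nbrs e A a = [set y] -> nbrs e A b = [set y] ->
  ~~ odd #|A| -> ~ reducible A.
Proof.
move=> ab aA bA eqa eqb evenA redA.
have [m mP] := reducible_even_matching redA evenA.
have [maA ema ma] := mP a aA; have [mbA emb mb] := mP b bA.
have /set1P may : m a \in [set y] by rewrite -eqa in_nbrs maA.
have /set1P mby : m b \in [set y] by rewrite -eqb in_nbrs mbA.
by move/eqP: ab; apply; rewrite -ma -mb may mby.
Qed.

(** * Lower bound for reducible sets *)

(* Guards are labelled by J, and several of them may share a vertex: this
   is what makes the game stable under the retraction of a pendant path. *)
Definition labelled_defence A J (Q : (V -> V) -> Prop) :=
  [/\ exists p, Q p,
      forall p, Q p -> {in J, forall i, p i \in A},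
      forall p, Q p -> {in J &, forall i j, Q (p \o tperm i j)}
    & forall p r, Q p -> r \in A ->
        exists q, [/\ Q q, exists2 i, i \in J & q i = r
                    & {in J, forall i, p i = q i \/ e (p i) (q i)}]].

Lemma tperm_in J i j k : i \in J -> j \in J -> k \in J -> tperm i j k \in J.
Proof. by move=> iJ jJ kJ; case: tpermP. Qed.

(** The labels are the vertices of one safe position. Exchanging two labels is harmless because [Q]
    sees only the set of occupied vertices. *)
Lemma defendable_labelled A k : defendable A k ->
  exists J Q, #|J| = k /\ labelled_defence A J Q.
Proof.
case=> Q [[J QJ] subQ respQ].
exists J, (fun p => Q (p @: J) /\ {in J &, injective p}).
split; first by have [] := subQ _ QJ.
split=> [|p [Qp _] i iJ|p [Qp p_inj] i j iJ jJ|p r [Qp p_inj] rA].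
- by exists id; rewrite imset_id; split=> // v w.
- by case: (subQ _ Qp) => /subsetP pA _; rewrite pA ?imset_f.
- have tJ : tperm i j @: J = J.
    apply/eqP; rewrite eqEcard card_imset ?leqnn ?andbT; last exact: perm_inj.
    by apply/subsetP=> _ /imsetP[h hJ ->]; apply: tperm_in.
  rewrite imset_comp tJ; split=> // v w vJ wJ /= eqp.
  by apply: (@perm_inj _ (tperm i j)); apply: p_inj eqp; apply: tperm_in.
- case: (respQ _ _ Qp rA) => D [+ + [f [f_inj f_move eqD]]].
  rewrite eqD -imset_comp => Qf /imsetP[i iJ ri].
  exists (f \o p); split; first (split=> // v w vJ wJ).
  + by move=> /= eqf; apply: p_inj => //; apply: f_inj eqf; apply: imset_f.
  + by exists i.
  + by move=> v vJ; case: (f_move (p v) (imset_f _ vJ)) => /= [->|]; [left | right].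
Qed.

(* Some guard is always on s or l. It is dropped, exchanging its label with
   that of another guard when it leaves {s, l}: both guards are then within
   distance one of {s, l} before and after the move, hence retracted to u. *)
Lemma labelled_defence_pendant A J Q s l u : pendant A s l u ->
  labelled_defence A J Q ->
  exists2 g, g \in J & exists Q', labelled_defence (A :\: [set s; l]) (J :\ g) Q'.
Proof.
move=> slu [[p0 Qp0] inQ permQ respQ].
(* An attack on [l] can be answered only from [s] or [l], so one of these is always guarded. *)
have guarded p : Q p -> exists2 h, h \in J & p h \in [set s; l].
  move=> Qp; case: (respQ p l Qp (pendant_leaf_in slu)) => q [_ [h hJ qh] mv].
  exists h => //; case: (mv h hJ) => [->|]; rewrite qh; first by rewrite set22.
  rewrite e_sym => elp; have : p h \in nbrs e A l by rewrite in_nbrs inQ.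
  by case: slu => _ _ -> _ /set1P->; rewrite set21.
have [g gJ p0g] := guarded p0 Qp0; exists g => //.
exists (fun p' => exists p, [/\ Q p, p g \in [set s; l]
                   & {in J :\ g, forall i, p' i = retract s l u (p i)}]).
split.
- by exists (retract s l u \o p0), p0.
- by move=> p' [p [Qp _ eqp]] i iJ; rewrite eqp // (retract_in slu) ?inQ; case/setD1P: iJ.
- move=> p' [p [Qp pg eqp]] i j /[dup] iJg /setD1P[ig iJ] /[dup] jJg /setD1P[jg jJ].
  exists (p \o tperm i j); split; [exact: permQ | by rewrite /= tpermD |].
  by move=> h hJ /=; rewrite eqp ?tperm_in.
move=> p' r [p [Qp pg eqp]] /setDP[rA rsl].
case: (respQ p r Qp rA) => q [Qq [i0 i0J qi0] mv].
have [h hJ qh] := guarded q Qq.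
(* Exchanging [g] and [h] puts the dropped label [g] back on [{s, l}]. *)
exists (retract s l u \o (q \o tperm g h)); split.
- exists (q \o tperm g h); split; [exact: permQ | by rewrite /= tpermL | by []].
- exists (tperm g h i0).
    rewrite !inE tperm_in // andbT; apply: contraNneq rsl => eqg.
    by rewrite -qi0 -(tpermK g h i0) eqg tpermL.
  by rewrite /= tpermK qi0 /retract (negPf rsl).
move=> i /[dup] iJg /setD1P[ig iJ]; rewrite eqp //=.
have [->|ih] := eqVneq i h.
  left; rewrite tpermR (retract_nbr (w := q g) slu pg) ?inQ //; last exact: mv.
  rewrite (retract_nbr (w := p h) slu qh) ?inQ //.
  by case: (mv h hJ) => [->|]; [left | rewrite e_sym; right].
rewrite tpermD 1?eq_sym //; apply: (retract_move slu); rewrite ?inQ //.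
exact: mv.
Qed.

Lemma reducible_labelled_ge A : reducible A ->
  forall J Q, labelled_defence A J Q -> beta A <= #|J|.
Proof.
move: A; refine (reducible_ind _ _) => [C clC C0 _ J Q [[p Qp] _ _ respQ]|A s l u slu IHA J Q].
  rewrite beta_clique // card_gt0; case/set0Pn: C0 => r rC.
  by case: (respQ p r Qp rC) => q [_ [i iJ _] _]; apply/set0Pn; exists i.
case/(labelled_defence_pendant slu) => g gJ [Q' /IHA].
by rewrite (pendant_beta slu) (cardsD1 g J) gJ.
Qed.

Lemma reducible_defendable_ge A k : reducible A -> defendable A k -> beta A <= k.
Proof.
by move=> redA /defendable_labelled[J [Q [<-]]]; apply: reducible_labelled_ge.
Qed.

(** * Connected induced subgraphs *)

(** Connectedness of the induced subgraph, stated through closed subsets rather than walks so that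
    the edge relation need not be restricted to [A]. *)
Definition connected A := forall C, C \subset A -> C != set0 ->
  (forall x y, x \in C -> y \in A -> e x y -> y \in C) -> C = A.

Lemma connected_setT : (forall x y, connect e x y) -> connected [set: V].
Proof.
move=> cV C _ /set0Pn[x xC] closedC; apply/setP=> y; rewrite inE.
rewrite -(@closed_connect _ e C _ x y) // => v w evw.
by apply/idP/idP => ?; [apply: closedC evw | apply: (closedC w); rewrite // e_sym].
Qed.

(** A closed part of [A :\: L] becomes closed in [A] after adding the leaves at [x] in case it
    contains [x]. *)
Lemma connected_del_leaves A L x : x \in A -> x \notin L ->
    {in L, forall l, nbrs e A l \subset [set x]} ->
  connected A -> connected (A :\: L).
Proof.
move=> xA xL nbrL cA C CAL C0 closedC.
have CA : C \subset A by apply: subset_trans CAL (subsetDl _ _).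
pose C' := C :|: [set l in L | (l \in A) && (x \in C)].
have nL l v : l \in L -> v \in A -> e l v -> v = x.
  move=> lL vA elv; apply/set1P; apply: (subsetP (nbrL l lL)).
  by rewrite in_nbrs vA.
have eqC' : C' = A.
  apply: cA.
  - by rewrite subUset CA; apply/subsetP=> v; rewrite inE => /and3P[].
  - by case/set0Pn: C0 => v vC; apply/set0Pn; exists v; rewrite inE vC.
  move=> v w /setUP[vC|vLC] wA evw; rewrite !inE wA /=; last first.
    by move: vLC; rewrite inE => /and3P[vL _ xC]; rewrite (nL v w vL wA evw) xC.
  have [wL|wL] := boolP (w \in L).
    have <- : v = x by apply: (nL w); rewrite ?(subsetP CA) // e_sym.
    by rewrite vC orbT.
  by rewrite (closedC v) // inE wL.
apply/eqP; rewrite eqEsubset CAL; apply/subsetP=> v /setDP[+ vL].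
by rewrite -eqC' !inE (negPf vL) orbF.
Qed.

Lemma connected_has_nbr A x : connected A -> 1 < #|A| -> x \in A ->
  exists2 y, y \in A & e x y.
Proof.
move=> cA A1 xA; apply: contrapT => noy.
suff eqA : [set x] = A by rewrite -eqA cards1 in A1.
apply: cA; first by rewrite sub1set.
  by apply/set0Pn; exists x; rewrite set11.
by move=> _ y /set1P-> yA exy; case: noy; exists y.
Qed.

(** * Longest paths in acyclic graphs *)

Definition simple_path_in A x p :=
  [&& path e x p, uniq (x :: p) & all [in A] (x :: p)].

Lemma simple_path_rev A x p : simple_path_in A x p ->
  simple_path_in A (last x p) (rev (belast x p)).
Proof.
case/and3P=> px ux Ax; rewrite /simple_path_in.
have -> : last x p :: rev (belast x p) = rev (x :: p).
  by rewrite [x :: p]lastI rev_rcons.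
rewrite rev_uniq all_rev ux Ax !andbT rev_path.
by rewrite (eq_path (e' := e)) // => v w; rewrite e_sym.
Qed.

(** A neighbour of [x] outside the path would extend it, and one beyond the second vertex would
    close a cycle. *)
Lemma longest_path_end A x p : acyclic e -> simple_path_in A x p ->
    (forall y q, simple_path_in A y q -> size q <= size p) ->
  #|nbrs e A x| <= 1.
Proof.
move=> acyc /and3P[px ux Ax] max_p.
suff hd w : w \in nbrs e A x -> w = head x p.
  by apply/card_le1_eqP=> v w /hd -> /hd ->.
rewrite in_nbrs => /andP[wA exw].
have wp : w \in p.
  apply/negPn/negP=> wp; suff /max_p : simple_path_in A w (x :: p) by rewrite ltnn.
  rewrite /simple_path_in /= e_sym exw px inE negb_or wp wA.
  rewrite /= in ux Ax; rewrite ux Ax !andbT.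
  by rewrite eq_sym edge_neq.
case/splitPr: wp px ux => p1 p2 px ux {Ax max_p}.
have /acyc : ucycle e (x :: rcons p1 w).
  move: px; rewrite -cat_rcons cat_path => /andP[px _].
  rewrite /ucycle /= rcons_path px last_rcons e_sym exw /=.
  by move: ux; rewrite -cat_rcons -cat_cons cat_uniq => /andP[].
by rewrite /= size_rcons; case: p1 {px ux}.
Qed.

(** These are the ends of a longest path, the second being treated by reversal. They differ because
    the path has at least one edge. *)
Lemma two_path_ends A x0 y0 : acyclic e -> x0 \in A -> y0 \in A -> e x0 y0 ->
  exists x y, [/\ x != y, x \in A, y \in A, #|nbrs e A x| <= 1 & #|nbrs e A y| <= 1].
Proof.
move=> acyc x0A y0A exy0.
pose P n := `[< exists x p, simple_path_in A x p /\ size p = n >].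
have P1 : P 1.
  apply/asboolP; exists x0, [:: y0]; split=> //.
  by rewrite /simple_path_in /= exy0 x0A y0A inE edge_neq.
have Pmax n : P n -> n <= #|V|.
  case/asboolP=> x [p [/and3P[_ ux _] <-]].
  by apply: ltnW; rewrite -[_.+1]/(size (x :: p)) -(card_uniqP ux) max_card.
case: (ex_maxnP (ex_intro _ 1 P1) Pmax) => n /asboolP[x [p [xp eqn]]] maxn.
have max_p y q : simple_path_in A y q -> size q <= size p.
  by move=> yq; rewrite eqn; apply: maxn; apply/asboolP; exists y, q.
have xp' := simple_path_rev xp.
have max_p' y q : simple_path_in A y q -> size q <= size (rev (belast x p)).
  by rewrite size_rev size_belast; apply: max_p.
exists x, (last x p); split.
- case: p {xp' max_p max_p'} xp eqn (maxn 1 P1) => [_ <- //|y p].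
  case/and3P=> _ /andP[+ _] _ _ _; apply: contraNneq => /= eqx; rewrite {1}eqx; exact: mem_last.
- by case/and3P: xp => _ _ /andP[].
- by case/and3P: xp' => _ _ /andP[].
- exact: longest_path_end xp max_p.
- exact: longest_path_end xp' max_p'.
Qed.

(** * Internal vertices, exposed stems and stars *)

Definition internals A := [set v | internal e A v].

Lemma leaf_nbrsE A x l : x \in A -> l \in leaf_nbrs e A x -> nbrs e A l = [set x].
Proof.
move=> xA; rewrite inE in_nbrs => /andP[/andP[lA exl] /andP[_ /cards1P[y eqy]]].
have : x \in nbrs e A l by rewrite in_nbrs xA e_sym.
by rewrite eqy => /set1P->.
Qed.

Lemma leaf_nbrs_sub A x : leaf_nbrs e A x \subset A.
Proof. by apply/subsetP=> v; rewrite !inE => /andP[/andP[]]. Qed.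

Lemma leaf_nbrs_edge A x l : l \in leaf_nbrs e A x -> e x l.
Proof. by rewrite !inE => /andP[/andP[]]. Qed.

Lemma leaf_not_internal A x l : l \in leaf_nbrs e A x -> l \notin internals A.
Proof. by rewrite [l \in internals A]inE inE /internal => /andP[_ ->]; rewrite andbF. Qed.

(** In a connected set with several vertices an internal vertex has degree at least two; if at most
    one neighbour is internal, some other neighbour is a leaf. *)
Lemma internal_exposed_stem A x : connected A -> 1 < #|A| ->
  x \in internals A -> #|nbrs e (internals A) x| <= 1 -> exposed_stem e A x.
Proof.
move=> cA A1; rewrite inE => /andP[xA xleaf] int1.
have deg2 : 1 < #|nbrs e A x|.
  have [y yA exy] := connected_has_nbr cA A1 xA.
  move: xleaf; rewrite /leaf xA /=.
  have : 0 < #|nbrs e A x| by apply/card_gt0P; exists y; rewrite in_nbrs yA.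
  by case: #|_| => [|[]].
have eqint : [set w in nbrs e A x | internal e A w] = nbrs e (internals A) x.
  apply/setP=> w; rewrite !inE andbC andbA; congr (_ && _).
  by rewrite /internal; case: (w \in A); rewrite ?andbF ?andbT.
rewrite /exposed_stem eqint int1 andbT /stem xA deg2 /=.
rewrite card_gt0; apply: contraTneq deg2 => noleaf.
rewrite -leqNgt; apply: leq_trans int1; apply: subset_leq_card.
apply/subsetP=> w wx; rewrite -eqint inE wx /=.
have : w \notin leaf_nbrs e A x by rewrite noleaf inE.
rewrite inE wx /= /internal => ->; rewrite andbT.
by move: wx; rewrite in_nbrs => /andP[].
Qed.

Lemma star_closed A x : connected A -> x \in A ->
  nbrs e A x = leaf_nbrs e A x -> A = x |: leaf_nbrs e A x.
Proof.
move=> cA xA eqL; symmetry; apply: cA.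
- by rewrite subUset sub1set xA leaf_nbrs_sub.
- by apply/set0Pn; exists x; rewrite setU11.
move=> v w /setU1P[-> wA exw|vL wA evw]; rewrite inE.
  by rewrite -eqL in_nbrs wA exw orbT.
by rewrite -(leaf_nbrsE xA vL) in_nbrs wA evw.
Qed.

(** Such a star is P3, to which the extra clause of EWS applies, leaving one leaf. *)
Lemma star_P3_reducible A x : x \in A -> A = x |: leaf_nbrs e A x ->
  #|leaf_nbrs e A x| = 2 -> reducible A.
Proof.
move=> xA eqA /eqP/cards2P[a [b [ab eqL]]].
have aL : a \in leaf_nbrs e A x by rewrite eqL set21.
have bL : b \in leaf_nbrs e A x by rewrite eqL set22.
have exa := leaf_nbrs_edge aL; have exb := leaf_nbrs_edge bL.
have bA := subsetP (leaf_nbrs_sub A x) _ bL.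
exists (A :\: [set a; x]); last first.
  left; apply/induces_completeP; suff -> : A :\: [set a; x] = [set b].
    by rewrite cards1; split=> // v w /set1P-> /set1P->; rewrite eqxx.
  apply/setP=> v; rewrite eqA eqL !inE negb_or.
  have [->|va] := eqVneq v a; first by rewrite (negPf ab).
  have [->|//] := eqVneq v x; first by rewrite (negPf (edge_neq exb)).
apply: connect1; apply/orP; right.
apply/existsP; exists a; apply/existsP; exists x; apply/existsP; exists b.
rewrite eqxx andbT; apply/and5P; split=> //; first by rewrite {1}eqA eqL setUCA setUA.
  by rewrite e_sym.
apply/negP=> eab; have : b \in nbrs e A a by rewrite in_nbrs bA.
by rewrite (leaf_nbrsE xA aL) inE eq_sym (negPf (edge_neq exb)).
Qed.

Lemma star_defendable x L : L != set0 -> x \notin L -> {in L, forall l, e x l} ->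
  defendable (x |: L) 2.
Proof.
move=> L0 xL exL; apply: (@defendable_add_leaves _ _ x) => //.
- exact: set11.
- by rewrite disjoints1.
apply: defendable_clique; last by apply/set0Pn; exists x; rewrite set11.
by move=> v w /set1P-> /set1P->; rewrite eqxx.
Qed.

Lemma weak_exposed_step A x : weak_stem e A x -> exposed_stem e A x ->
  exists B, ews e A B.
Proof.
move=> wx ex; have /andP[/and3P[_ _ /card_gt0P[l lx]] _] := wx.
exists (A :\: [set x; l]); apply/orP; left; apply/existsP; exists x.
by apply/existsP; exists l; rewrite wx ex lx eqxx.
Qed.

(** * Strict inequality for irreducible sets *)

(** A connected nonempty set of at most two vertices is a clique, hence K1 or K2. *)
Lemma irreducible_card A : connected A -> A != set0 -> ~ reducible A -> 2 < #|A|.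
Proof.
move=> cA A0 irrA; rewrite ltnNge; apply/negP=> A2; apply: irrA.
suff clA : clique A.
  exists A => //; move: A0 A2; rewrite -card_gt0.
  case eqn: #|A| => [|[|[]]] // _ _; [left | right]; exact/induces_completeP.
move=> x y xA yA xy.
have eqA : [set x; y] = A.
  by apply/eqP; rewrite eqEcard subUset !sub1set xA yA cards2 xy.
have A1 : 1 < #|A| by rewrite -eqA cards2 xy.
have [z] := connected_has_nbr cA A1 xA.
by rewrite -eqA => /set2P[->|-> //]; rewrite e_irr.
Qed.

(** If all vertices were leaves, the two ends of an edge would form a whole component. *)
Lemma internal_exists A : connected A -> 2 < #|A| -> exists x, x \in internals A.
Proof.
move=> cA A2; apply: contrapT => noint.
have leafA v : v \in A -> leaf e A v.
  move=> vA; apply/negPn/negP=> lv; apply: noint; exists v.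
  by rewrite inE /internal vA.
have /card_gt0P[x xA] : 0 < #|A| by apply: leq_trans A2.
have [y yA exy] := connected_has_nbr cA (ltnW A2) xA.
have eqn v w : v \in A -> w \in A -> e v w -> nbrs e A v = [set w].
  move=> vA wA evw; have /andP[_ /cards1P[z eqz]] := leafA v vA.
  by have := mem_nbrs wA evw; rewrite eqz => /set1P->.
suff eqA : [set x; y] = A by move: A2; rewrite -eqA cards2; case: (x != y).
apply: cA; first by rewrite subUset !sub1set xA.
  by apply/set0Pn; exists x; rewrite set21.
move=> v w /set2P[]-> wA evw.
  have : w \in nbrs e A x by rewrite in_nbrs wA.
  by rewrite (eqn x y) // => /set1P->; rewrite set22.
have : w \in nbrs e A y by rewrite in_nbrs wA.
by rewrite (eqn y x) ?(e_sym y) // => /set1P->; rewrite set21.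
Qed.

Lemma nbrs_del A L v w : w \notin L -> nbrs e A v = [set w] ->
  nbrs e (A :\: L) v = [set w].
Proof.
move=> wL eqw; apply/setP=> z; move/setP/(_ z): eqw.
rewrite !in_nbrs !inE; have [->|] := eqVneq z w; first by rewrite wL.
by move=> _; rewrite -andbA => ->; rewrite andbF.
Qed.

Lemma irreducible_two_strong_stems A x y :
    (forall B, #|B| < #|A| -> connected B -> B != set0 -> ~ reducible B ->
       exists2 k, k < beta B & defendable B k) ->
    connected A -> x != y -> x \in internals A -> y \in internals A ->
    #|nbrs e (internals A) x| <= 1 ->
    1 < #|leaf_nbrs e A x| -> 1 < #|leaf_nbrs e A y| ->
  exists2 k, k < beta A & defendable A k.
Proof.
move=> IHA cA xy xI yI int1 Lx2 /card_gt1P[a [b [aL bL ab]]].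
set L := leaf_nbrs e A x in Lx2.
have /andP[xA _] : internal e A x by rewrite inE in xI.
have /andP[yA _] : internal e A y by rewrite inE in yI.
have LA : L \subset A := leaf_nbrs_sub A x.
have inL v : v \in internals A -> v \notin L.
  by apply: contraTN => /leaf_not_internal.
have nbrL : {in L, forall l, nbrs e A l \subset [set x]}.
  by move=> l lL; rewrite (leaf_nbrsE xA lL).
have yL z : z \in leaf_nbrs e A y -> (z \in A) && (z \notin x |: L).
  move=> zL; rewrite (subsetP (leaf_nbrs_sub A y)) // in_setU1 negb_or /=.
  apply/andP; split.
    by apply: contraTneq xI => <-; apply: leaf_not_internal zL.
  apply/negP=> zLx; move/eqP: (leaf_nbrsE xA zLx).
  by rewrite (leaf_nbrsE yA zL) eqEsubset sub1set inE eq_sym (negPf xy).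
have yxL : y \notin x |: L by rewrite in_setU1 negb_or eq_sym xy inL.
(* Once [L] is gone, all neighbours of [x] are internal in [A], so at most one is left. *)
have nbrsx : nbrs e (A :\: L) x \subset nbrs e (internals A) x.
  apply/subsetP=> w; rewrite in_nbrs => /andP[/setDP[wA wL] exw].
  apply: mem_nbrs => //; rewrite inE /internal wA /=.
  by apply: contraNN wL => lw; rewrite inE mem_nbrs.
have cT' : connected (A :\: L) := connected_del_leaves xA (inL _ xI) nbrL cA.
have eqT : A :\: (x |: L) = (A :\: L) :\: [set x] by rewrite setDDl setUC.
have ltT' : #|A :\: L| < #|A|.
  by rewrite -(cardsID L A) (setIidPr LA) -[X in X < _]add0n ltn_add2r ltnW.
have cardT : #|A :\: L| = #|A :\: (x |: L)|.+1.
  by rewrite eqT (cardsD1 x) inE xA inL.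
have betaA := beta_add_leaves LA (inL _ xI) nbrL.
(* The twin leaves [a] and [b] at [y] survive the deletion of [M]. *)
have irr (M : {set V}) : M \subset x |: L -> ~~ odd #|A :\: M| -> ~ reducible (A :\: M).
  move=> /subsetP ML; have [/andP[aA aM] /andP[bA bM]] := (yL a aL, yL b bL).
  have nM v : v \notin x |: L -> v \notin M by apply: contraNN; apply: ML.
  by apply: (twin_leaves_irreducible (y := y) ab); rewrite ?inE ?nM //;
    apply: nbrs_del; rewrite ?nM // (leaf_nbrsE yA).
have L0 : L != set0 by rewrite -card_gt0 ltnW.
have exL : {in L, forall l, e x l} by move=> l; apply: leaf_nbrs_edge.
have [oddT|evenT] := boolP (odd #|A :\: (x |: L)|).
  have [||||k ltk defk] := IHA (A :\: L) => //.
  - by apply/set0Pn; exists x; rewrite inE inL.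
  - by apply: irr; [exact: subsetUr | rewrite cardT /= negbK].
  (* With T = [A :\: (x |: L)] and T' = [A :\: L], [beta] of [A] is at least [beta] of T plus 2,
     hence at least [beta] of T' plus 1, which exceeds [k.+1]. *)
  exists k.+1.
    have clx : clique [set x] by move=> v w /set1P-> /set1P->; rewrite eqxx.
    have := beta_del_clique (A :\: L) clx; rewrite -eqT => betaT'.
    apply: leq_trans betaA; apply: leq_trans (leq_add (leqnn _) Lx2).
    by rewrite addn2 ltnS; apply: leq_trans ltk betaT'.
  rewrite -(setID A L) (setIidPr LA) setUC.
  apply: (@defendable_add_leaves _ _ x) => //; last by rewrite disjoint_sym disjoint_setD.
  by rewrite inE inL.
have [||||k ltk defk] := IHA (A :\: (x |: L)) => //.
- by rewrite cardT in ltT'; apply: ltnW.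
(* As [A :\: L] is connected and contains [y], the vertex [x] keeps a neighbour [u], its only one.
   Deleting [x] thus deletes a leaf. *)
- rewrite eqT; have [nbrs0|/set0Pn[u ux]] := eqVneq (nbrs e (A :\: L) x) set0.
    have eqx : [set x] = A :\: L.
      apply: cT'; first by rewrite sub1set inE inL.
        by apply/set0Pn; exists x; rewrite set11.
      by move=> _ w /set1P-> wT exw; have := mem_nbrs wT exw; rewrite nbrs0 in_set0.
    have : y \in A :\: L by rewrite inE inL.
    by rewrite -eqx inE eq_sym (negPf xy).
  move: (ux); rewrite in_nbrs => /andP[uT exu].
  apply: (connected_del_leaves (x := u)) cT' => //.
    by rewrite inE eq_sym edge_neq.
  move=> _ /set1P->; apply/subsetP=> w wx; rewrite inE; apply/eqP.
  by apply: (card_le1_eqP int1); apply: (subsetP nbrsx).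
- by apply/set0Pn; exists y; rewrite inE yxL.
- by apply: irr.
(* The star on [x] and [L] takes two guards, and [L] contributes at least two independent
   vertices. *)
exists (2 + k); first by apply: leq_trans betaA; rewrite addnC -addSn leq_add.
have sub : x |: L \subset A by rewrite subUset sub1set xA.
rewrite -(setID A (x |: L)) (setIidPr sub); apply: defendableU defk.
  exact: disjoint_setD.
by apply: star_defendable; rewrite ?inL.
Qed.

Lemma irreducible_defendable_lt A : acyclic e -> connected A -> A != set0 ->
  ~ reducible A -> exists2 k, k < beta A & defendable A k.
Proof.
move=> acyc; have [n] := ubnP #|A|; elim: n A => // n IHn A ltAn cA A0 irrA.
have {}IHn B : #|B| < #|A| -> connected B -> B != set0 -> ~ reducible B ->
    exists2 k, k < beta B & defendable B k.
  by move=> ltBA; apply: IHn; apply: leq_trans ltBA _.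
have A2 := irreducible_card cA A0 irrA.
(* If EWS applies, the inequality passes from the smaller set to [A], both sides growing by one. *)
have [[B AB]|stuck] := pselect (exists B, ews e A B).
  have irrB : ~ reducible B by move/(reducible_ews AB).
  case/ews_pendant: AB irrB => s [l [u [slu ->]]] irrB.
  have cardA := pendant_card slu.
  have [||||k ltk defk] := IHn (A :\: [set s; l]) => //.
  - by rewrite cardA ltnW.
  (* Connectedness survives deleting first [l] and then [s], which has become a leaf at [u]. *)
  - have -> : A :\: [set s; l] = (A :\: [set l]) :\: [set s] by rewrite setDDl setUC.
    case: (slu) => sA ul eql eqs; have sl := edge_neq (pendant_edge slu).
    apply: (connected_del_leaves (x := u)).
    + by rewrite !inE ul (pendant_root_in slu).
    + by rewrite inE eq_sym edge_neq // (pendant_root_edge slu).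
    + move=> _ /set1P->; apply/subsetP=> w; rewrite in_nbrs !inE => /andP[/andP[wl wA] esw].
      by have := mem_nbrs wA esw; rewrite eqs !inE (negPf wl).
    + apply: (connected_del_leaves (x := s)) cA => //; first by rewrite inE.
      by move=> _ /set1P->; rewrite eql.
  - by rewrite -card_gt0; move: A2; rewrite cardA.
  exists k.+1; first by rewrite (pendant_beta slu).
  exact: pendant_defendable slu _ defk.
(* As EWS is stuck, no exposed stem is weak. *)
have strong x : exposed_stem e A x -> 1 < #|leaf_nbrs e A x|.
  move=> ex; have /andP[sx _] := ex; have /and3P[_ _ L0] := sx.
  rewrite ltn_neqAle eq_sym L0 andbT; apply/negP=> /eqP L1; apply: stuck.
  by apply: weak_exposed_step ex; rewrite /weak_stem sx L1.
have [x0 x0I] := internal_exists cA A2.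
(* If [x0] has no internal neighbour, [A] is a star with centre [x0]. *)
have [noint|/set0Pn[y0]] := eqVneq (nbrs e (internals A) x0) set0.
  have /strong L2 : exposed_stem e A x0.
    by apply: internal_exposed_stem => //; [exact: ltnW | rewrite noint cards0].
  have x0A : x0 \in A by move: x0I; rewrite inE => /andP[].
  have eqL : nbrs e A x0 = leaf_nbrs e A x0.
    apply/setP=> w; rewrite [in RHS]inE; case: (boolP (w \in nbrs _ _ _)) => //=.
    rewrite in_nbrs => /andP[wA exw]; symmetry; apply/negPn/negP=> lw.
    have : w \in nbrs e (internals A) x0 by rewrite in_nbrs exw inE /internal wA lw.
    by rewrite noint inE.
  have eqA := star_closed cA x0A eqL.
  have x0L : x0 \notin leaf_nbrs e A x0 by apply: contraTN x0I => /leaf_not_internal.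
  exists 2; last first.
    rewrite eqA; apply: star_defendable => //; first by rewrite -card_gt0 ltnW.
    by move=> l /leaf_nbrs_edge.
  (* Exactly two leaves would give the reducible P3; three leaves already outnumber the two
     guards. *)
  have L3 : 2 < #|leaf_nbrs e A x0|.
    rewrite ltn_neqAle L2 andbT; apply/negP=> /eqP/esym L2'.
    exact: irrA (star_P3_reducible x0A eqA L2').
  apply: leq_trans L3 _; apply: leq_trans (leq_addl _ _) (beta_add_leaves _ x0L _).
    exact: leaf_nbrs_sub.
  by move=> l lL; rewrite (leaf_nbrsE x0A lL).
rewrite in_nbrs => /andP[y0I exy0].
(* The path runs among internal vertices only, so that its ends are exposed stems of [A]. *)
have [x [y [xy xI yI x1 y1]]] := two_path_ends acyc x0I y0I exy0.
apply: (irreducible_two_strong_stems IHn cA xy xI yI x1); apply: strong;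
  by apply: internal_exposed_stem => //; apply: ltnW.
Qed.

End Guards.

Theorem theorem6p6 (V : finType) (e : rel V) (treeV : tree e)
    (V_gt1 : 2 <= #|V|) :
  independence_number e = m_eternal_domination_number e <->
  exists2 B : {set V}, connect (ews e) [set: V] B
                     & induces_complete e B 1 \/ induces_complete e B 2.
Proof.
have [[e_sym e_irr] V_gt0 e_conn acyc] := treeV; rewrite -beta_setT.
split=> [eq_beta|redV].
  apply: contrapT => irrV.
  have [||||k ltk /(m_eternal_le e_sym)] :=
      @irreducible_defendable_lt _ e e_sym e_irr [set: V] => //.
  - exact: connected_setT.
  - by rewrite -card_gt0 cardsT.
  by rewrite -eq_beta leqNgt ltk.
apply/eqP; rewrite eqn_leq; apply/andP; split.
  exact: reducible_defendable_ge (m_eternal_defendable e V_gt0).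
exact/(m_eternal_le e_sym)/reducible_defendable.
Qed.
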